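(* Consider probabilistic direct search (PDS, as described in the context) with $f:\mathbb{R}^n\to\mathbb{R}$ convex on $\mathbb{R}^n$ (not necessarily differentiable). Let $p_*=\dfrac{\log\gamma}{\log(\theta^{-1}\gamma)}$. Suppose that $\{\mathfrak{D}_k\}$ is a sequence of $p$-probabilistic ascent sets in the nonsmooth sense defined in the context, with $p>p_*$. (i) For any lower semicontinuous function $\mu:\mathbb{R}^n\to(-\infty,\infty]$ with $\mu(x_0)>0$, $$\mathbb{P}\Big(\inf_{k\ge 0}\mu(X_k)>0\Big)>0.$$ In particular, this holds if $\mu$ is $f(\cdot)-\inf f$, $\operatorname{gap}(\,\cdot\,,\mathcal{S}(f))$, or $\operatorname{gap}(0,\partial_{\mathrm C}f(\cdot))$, and $x_0$ is not stationary (i.e. $0\notin\partial_{\mathrm C}f(x_0)$). (ii) If $\mu:\mathbb{R}^n\to(-\infty,\infty]$ is lower semicontinuous with $\mu(x_0)>0$ and is locally Lipschitz continuous at $x_0$, then there exist constants $C>0$ and $\overline{\zeta}>0$ such that $$\mathbb{P}\Big(\inf_{k\ge 0}\mu(X_k)\ge(1-\zeta)\,\mu(x_0)\Big)\ge C\,\zeta^{\frac{\log p}{\log\theta}}\quad\text{for all }\zeta\in(0,\overline{\zeta}).$$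
   Context: PDS. Fix $n\ge 1$, an objective $f:\mathbb{R}^n\to\mathbb{R}$, a deterministic starting point $x_0\in\mathbb{R}^n$, a deterministic initial step size $\alpha_0>0$, constants $\theta\in(0,1)$ and $\gamma\in[1,\infty)$, and a forcing function $\rho:(0,\infty)\to(0,\infty)$, which is nondecreasing with $\rho(\alpha)=o(\alpha)$ as $\alpha\to 0^+$. On a probability space $(\Omega,\mathcal{F},\mathbb{P})$, PDS generates random polling direction sets $\mathfrak{D}_k$, random iterates $X_k$ and random step sizes $A_k$, $k\ge 0$, with $X_0=x_0$, $A_0=\alpha_0$, as follows. For each $k\ge 0$, $\mathfrak{D}_k$ is nonempty and consists of finitely many random vectors in $\mathbb{R}^n$ of Euclidean norm $1$. If some $d\in\mathfrak{D}_k$ satisfies $f(X_k)-f(X_k+A_kd)>\rho(A_k)$, then $X_{k+1}=X_k+A_kd_k$ for some $d_k\in\mathfrak{D}_k$ satisfying this inequality (the selection rule is unspecified and may involve additional randomness) and $A_{k+1}=\gamma A_k$; otherwise $X_{k+1}=X_k$ and $A_{k+1}=\theta A_k$. Filtration: $\mathcal{F}_{-1}=\{\emptyset,\Omega\}$ and $\mathcal{F}_k=\sigma(\mathfrak{D}_0,X_1,\dots,\mathfrak{D}_k,X_{k+1})$ for $k\ge 0$. Equalities and inequalities involving conditional probabilities given a $\sigma$-algebra are understood almost surely. Clarke notions: for $f$ locally Lipschitz, $f^\circ(x;d)=\limsup_{y\to x,\,t\downarrow 0}\frac{f(y+td)-f(y)}{t}$ and $\partial_{\mathrm C}f(x)=\{g\in\mathbb{R}^n:g^{\mathsf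 T}d\le f^\circ(x;d)\ \forall d\in\mathbb{R}^n\}$. For convex $f$ they coincide with the one-sided directional derivative and the convex subdifferential. Probabilistic ascent (nonsmooth): for $f$ locally Lipschitz (automatic for convex real-valued $f$) and $p\in[0,1]$, $\{\mathfrak{D}_k\}$ is a sequence of $p$-probabilistic ascent sets if $\mathbb{P}\big(\min_{\mathfrak{d}\in\mathfrak{D}_k}f^\circ(X_k;\mathfrak{d})\ge 0\mid\mathcal{F}_{k-1}\big)\ge p$ for each $k\ge 0$. Notation: $\inf f=\inf_{x\in\mathbb{R}^n}f(x)$ (possibly $-\infty$), $\mathcal{S}(f)=\{x\in\mathbb{R}^n:f(x)=\inf f\}$ (possibly empty), $\operatorname{gap}(A,B)=\inf\{\|a-b\|:a\in A,b\in B\}$ ($=\infty$ if $A$ or $B$ is empty), $\operatorname{gap}(a,B)=\operatorname{gap}(\{a\},B)$. Locally Lipschitz continuous at $x_0$ means that $\mu$ is finite and Lipschitz continuous on some neighborhood of $x_0$. *)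

(* Defs.v *)
From HB Require Import structures.
From mathcomp Require Export all_boot all_order all_algebra.
From mathcomp Require Export all_classical all_reals all_analysis.

Set Implicit Arguments.
Unset Strict Implicit.
Unset Printing Implicit Defensive.

Import Order.TTheory GRing.Theory Num.Theory.
Import numFieldNormedType.Exports.

Local Open Scope classical_set_scope.
Local Open Scope ring_scope.

(* The library norm of 'rV[R]_n is the sup norm, hence this one. The two induce
   the same topology, so nbhs and open can be taken from the library. *)
Definition enorm (R : realType) (n : nat) (x : 'rV[R]_n) : R :=
  Num.sqrt (\sum_(i < n) x 0 i ^+ 2).

Definition dotv (R : realType) (n : nat) (x y : 'rV[R]_n) : R :=
  \sum_(i < n) x 0 i * y 0 i.

(* Infima are in \bar R, where ereal_inf set0 = +oo. *)
Definition gap (R : realType) (n : nat) (A B : set 'rV[R]_n) : \bar R :=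
  ereal_inf [set (enorm (ab.1 - ab.2))%:E | ab in A `*` B].

Definition infimum (R : realType) (n : nat) (f : 'rV[R]_n -> R) : \bar R :=
  ereal_inf [set (f x)%:E | x in setT].

Definition minimizers (R : realType) (n : nat) (f : 'rV[R]_n -> R) :
    set 'rV[R]_n :=
  [set x | (f x)%:E = infimum f].

Definition clarke_derivative (R : realType) (n : nat) (f : 'rV[R]_n -> R)
    (x d : 'rV[R]_n) : \bar R :=
  limf_esup
    (fun yt : 'rV[R]_n * R => ((f (yt.1 + yt.2 *: d) - f yt.1) / yt.2)%:E)
    (filter_prod (nbhs x) (at_right (0 : R))).

Definition clarke_subdifferential (R : realType) (n : nat)
    (f : 'rV[R]_n -> R) (x : 'rV[R]_n) : set 'rV[R]_n :=
  [set g | forall d, ((dotv g d)%:E <= clarke_derivative f x d)%E].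

Definition stationary (R : realType) (n : nat) (f : 'rV[R]_n -> R)
    (x : 'rV[R]_n) : Prop :=
  clarke_subdifferential f x 0.

Definition locally_lipschitz_at (R : realType) (n : nat)
    (mu : 'rV[R]_n -> \bar R) (x0 : 'rV[R]_n) : Prop :=
  exists2 U : set 'rV[R]_n, nbhs x0 U &
    (forall x, U x -> mu x \is a fin_num) /\
    (exists L : R, forall x y, U x -> U y ->
       `|fine (mu x) - fine (mu y)| <= L * enorm (x - y)).

Definition forcing_function (R : realType) (rho : R -> R) : Prop :=
  [/\ forall a, 0 < a -> 0 < rho a,
      forall a b, 0 < a -> a <= b -> rho a <= rho b &
      (rho : R -> R^o) =o_ ((0 : R)^'+) (id : R -> R^o)].

Notation borel T := (g_sigma_algebraType (@open T)).

(* A random finite set is given by a random finite enumeration of it, of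
   possibly random length; indices beyond the length give the default 0. *)
Definition random_directions (R : realType) (n : nat) (d : measure_display)
    (Omega : measurableType d) (D : Omega -> seq 'rV[R]_n) : Prop :=
  measurable_fun setT (fun w => size (D w)) /\
  forall i, measurable_fun setT (fun w => nth 0 (D w) i : borel 'rV[R]_n).

Definition directions_sigma (R : realType) (n : nat) (Omega : pointedType)
    (D : Omega -> seq 'rV[R]_n) : set (set Omega) :=
  <<s g_sigma_algebra_preimage (fun w => size (D w)) `|`
      \bigcup_(i in [set: nat])
        g_sigma_algebra_preimage (fun w => nth 0 (D w) i : borel 'rV[R]_n) >>.

(* past D X k is the sigma-algebra F_(k-1) generated by
   D_0, X_1, ..., D_(k-1), X_k; for k = 0 it is <<s set0 >> = {set0, setT}. *)
Definition past (R : realType) (n : nat) (Omega : pointedType)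
    (D : nat -> Omega -> seq 'rV[R]_n) (X : nat -> Omega -> 'rV[R]_n)
    (k : nat) : set (set Omega) :=
  <<s \bigcup_(j in [set j | (j < k)%N])
        (directions_sigma (D j) `|`
         g_sigma_algebra_preimage (X j.+1 : Omega -> borel 'rV[R]_n)) >>.

Definition sufficient_decrease (R : realType) (n : nat) (f : 'rV[R]_n -> R)
    (rho : R -> R) (x : 'rV[R]_n) (a : R) (d : 'rV[R]_n) : Prop :=
  rho a < f x - f (x + a *: d).

Record PDS (R : realType) (n : nat) (f : 'rV[R]_n -> R) (x0 : 'rV[R]_n)
    (alpha0 theta gamma : R) (rho : R -> R)
    (disp : measure_display) (Omega : measurableType disp)
    (D : nat -> Omega -> seq 'rV[R]_n) (X : nat -> Omega -> 'rV[R]_n)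
    (A : nat -> Omega -> R) : Prop := {
  PDS_random_directions : forall k, random_directions (D k);
  PDS_random_iterates :
    forall k, measurable_fun setT (X k : Omega -> borel 'rV[R]_n);
  PDS_random_steps : forall k, measurable_fun setT (A k);
  PDS_nonempty : forall k w, D k w != [::];
  PDS_unit : forall k w d, d \in D k w -> enorm d = 1;
  PDS_X0 : forall w, X 0%N w = x0;
  PDS_A0 : forall w, A 0%N w = alpha0;
  PDS_success : forall k w,
    (exists2 d, d \in D k w &
       sufficient_decrease f rho (X k w) (A k w) d) ->
    (exists d, [/\ d \in D k w,
       sufficient_decrease f rho (X k w) (A k w) d &
       X k.+1 w = X k w + A k w *: d]) /\
    A k.+1 w = gamma * A k w;
  PDS_failure : forall k w,
    ~ (exists2 d, d \in D k w &
         sufficient_decrease f rho (X k w) (A k w) d) ->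
    X k.+1 w = X k w /\ A k.+1 w = theta * A k w
}.

(* Z is a version of the conditional probability of the event E given the
   sub-sigma-algebra G; it is unique up to P-negligible sets. *)
Definition conditional_probability (R : realType) (disp : measure_display)
    (Omega : measurableType disp) (P : probability Omega R)
    (G : set (set Omega)) (E : set Omega) (Z : Omega -> R) : Prop :=
  [/\ forall B : set R, measurable B -> G (Z @^-1` B),
      P.-integrable setT (EFin \o Z) &
      forall H, G H -> (\int[P]_(w in H) (Z w)%:E = P (E `&` H))%E].

Definition ascent_event (R : realType) (n : nat) (f : 'rV[R]_n -> R)
    (Omega : Type) (D : Omega -> seq 'rV[R]_n) (X : Omega -> 'rV[R]_n) :
    set Omega :=
  [set w | (0 <= \big[Order.min/+oo]_(d <- D w)
                   clarke_derivative f (X w) d)%E].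

Definition probabilistic_ascent (R : realType) (n : nat)
    (f : 'rV[R]_n -> R) (disp : measure_display)
    (Omega : measurableType disp) (P : probability Omega R)
    (D : nat -> Omega -> seq 'rV[R]_n) (X : nat -> Omega -> 'rV[R]_n)
    (p : R) : Prop :=
  forall k, exists2 Z : Omega -> R,
    conditional_probability P (past D X k) (ascent_event f (D k) (X k)) Z &
    {ae P, forall w, p <= Z w}.

Definition inf_along (R : realType) (n : nat) (Omega : Type)
    (X : nat -> Omega -> 'rV[R]_n) (mu : 'rV[R]_n -> \bar R) (w : Omega) :
    \bar R :=
  ereal_inf [set mu (X k w) | k in [set: nat]].

Definition p_star (R : realType) (theta gamma : R) : R :=
  ln gamma / ln (theta^-1 * gamma).

(* Main.v *)
Require Import Defs.
From mathcomp Require Import ring lra measurable_realfun.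
Set Implicit Arguments.
Unset Strict Implicit.
Unset Printing Implicit Defensive.
Import Order.TTheory GRing.Theory Num.Theory.
Import numFieldNormedType.Exports.
Local Open Scope classical_set_scope.
Local Open Scope ring_scope.

(** For a convex [f], the slope of [f] along a ray is nondecreasing in the step,
    so a direction [d] with [0 <= f°(x; d)] never decreases [f], whatever the
    step size ([clarke_ge0P]). Hence the iteration stalls on the ascent event,
    and, conditionally on the past, every iteration stalls with probability at
    least [p] ([stay_probability]). A stalled iteration multiplies the step
    size by [theta], any other one by [gamma]; the iteration stalls exactly
    when the iterate does not move, an event that the iterates alone reveal.

    The condition [p_star < p] says that the logarithm of the step size has
    negative drift, or equivalently that
    [r := p * theta `^ s + (1 - p) * gamma `^ s < 1] for some [s > 0]
    ([powR_drift_lt1]). The [s]-th power of the step size is then a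
    supermartingale with ratio [r]. Splitting on whether the first step stalls
    gives a Markov type bound on the probability that the step size is still
    at least [t] after [j] steps ([step_tail]), and a union bound over [j]
    shows that the step sizes decay geometrically forever with conditional
    probability at least 1/2 ([walk_decay]).

    With probability at least [p ^+ m] the first [m] iterations all stall,
    which brings the step size down to [theta ^+ m * alpha0] without moving
    the iterate. With the geometric decay after time [m], all the iterates stay
    within [M * theta ^+ m] of [x0] with probability at least [p ^+ m / 2],
    where [M] does not depend on [m] ([iterates_localized]). Any lower
    semicontinuous [mu] that is positive at [x0] is bounded away from [0] near
    [x0], which gives (i) on taking [m] large; for (ii), [mu] drops by at most a
    multiple of [M * theta ^+ m], and choosing [m] close to
    [ln (b * zeta) / ln theta] turns [p ^+ m] into a constant times
    [zeta `^ (ln p / ln theta)].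

    It remains to see that the three classical optimality measures are lower
    semicontinuous. For the two distances this is a compactness argument
    ([lsc_inf_enorm_section]) for sets with a closed graph. *)

(** * The Euclidean norm and the sup norm *)

Lemma norm_le_enorm (R : realType) (n : nat) (x : 'rV[R]_n) : `|x| <= enorm x.
Proof.
rewrite /Num.Def.normr /= mx_normrE; apply/bigmax_leP; split.
  exact: sqrtr_ge0.
move=> [i j] _ /=; rewrite (ord1 i) -sqrtr_sqr ler_wsqrtr//.
by rewrite (bigD1 j)//= lerDl sumr_ge0// => k _; exact: sqr_ge0.
Qed.

Lemma coord_le_norm (R : realType) (n : nat) (x : 'rV[R]_n) i : `|x 0 i| <= `|x|.
Proof.
rewrite [leRHS]/Num.Def.normr /= mx_normrE.
by apply/bigmax_geP; right; exists (0, i).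
Qed.

Lemma enorm_le_norm (R : realType) (n : nat) (x : 'rV[R]_n) :
  enorm x <= Num.sqrt n%:R * `|x|.
Proof.
rewrite -[`|x|]normr_id -sqrtr_sqr -sqrtrM ?ler0n// ler_wsqrtr//.
rewrite (le_trans (_ : _ <= \sum_(i < n) `|x| ^+ 2))//.
  apply: ler_sum => i _; rewrite -real_normK ?num_real//.
  by rewrite lerXn2r ?nnegrE// coord_le_norm.
by rewrite sumr_const card_ord mulr_natl.
Qed.

Lemma enorm0 (R : realType) (n : nat) : enorm (0 : 'rV[R]_n) = 0.
Proof. by rewrite /enorm big1 ?sqrtr0// => i _; rewrite mxE expr0n. Qed.

Lemma enormN (R : realType) (n : nat) (x : 'rV[R]_n) : enorm (- x) = enorm x.
Proof. by congr Num.sqrt; apply: eq_bigr => i _; rewrite mxE sqrrN. Qed.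

Lemma cvg_sum_seq (R : realType) (T I : Type) (F : set_system T)
    {FF : Filter F} (s : seq I) (f : I -> T -> R) (l : I -> R) :
  (forall i, f i x @[x --> F] --> l i) ->
  \sum_(i <- s) f i x @[x --> F] --> \sum_(i <- s) l i.
Proof.
move=> fl; elim: s => [|i s IH].
  under eq_cvg do rewrite big_nil.
  by rewrite big_nil; exact: cvg_cst.
under eq_cvg do rewrite big_cons.
by rewrite big_cons; exact: cvgD.
Qed.

Lemma enorm_continuous (R : realType) (n : nat) : continuous (@enorm R n).
Proof.
move=> x; apply: (cvg_comp (fun x : 'rV[R]_n => \sum_(i < n) x 0 i ^+ 2) Num.sqrt).
  apply: (cvg_sum_seq (F := nbhs x)) => i.
  by apply: cvgM; exact: coord_continuous.
exact: sqrt_continuous.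
Qed.

Lemma dotvZr (R : realType) (n : nat) (g d : 'rV[R]_n) (t : R) :
  dotv g (t *: d) = t * dotv g d.
Proof.
by rewrite /dotv mulr_sumr; apply: eq_bigr => i _; rewrite mxE mulrCA.
Qed.

Lemma dot0v (R : realType) (n : nat) (v : 'rV[R]_n) : dotv 0 v = 0.
Proof. by rewrite /dotv big1// => i _; rewrite mxE mul0r. Qed.

Lemma cvg_dotv (R : realType) (n : nat) (T : Type) (F : set_system T)
    {FF : Filter F} (u v : T -> 'rV[R]_n) (a b : 'rV[R]_n) :
  u @ F --> a -> v @ F --> b -> dotv (u x) (v x) @[x --> F] --> dotv a b.
Proof.
move=> ua vb; apply: cvg_sum_seq => i.
by apply: cvgM; [apply: (cvg_comp u (fun w : 'rV[R]_n => w 0 i) ua) |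
  apply: (cvg_comp v (fun w : 'rV[R]_n => w 0 i) vb)]; exact: coord_continuous.
Qed.

(** * Continuity of convex functions *)

Lemma convex_ineq (R : realType) (n : nat) (f : 'rV[R]_n -> R)
    (f_convex : convex_function (setT : set (convex_lmodType 'rV[R]_n)) f)
    (t : R) (x y : 'rV[R]_n) : 0 <= t -> t <= 1 ->
  f (t *: x + (1 - t) *: y) <= t * f x + (1 - t) * f y.
Proof.
move=> t0 t1.
exact: (f_convex (Itv01 t0 t1) x y (in_setT _) (in_setT _)).
Qed.

(** Jensen's inequality for equal weights. *)
Lemma convex_mean (R : realType) (n m : nat) (f : 'rV[R]_n -> R)
    (f_convex : convex_function (setT : set (convex_lmodType 'rV[R]_n)) f)
    (y : nat -> 'rV[R]_n) :
  f (m.+1%:R^-1 *: \sum_(0 <= i < m.+1) y i) <=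
    m.+1%:R^-1 * \sum_(0 <= i < m.+1) f (y i).
Proof.
elim: m => [|m IH]; first by rewrite !big_nat1 invr1 scale1r mul1r.
rewrite !(big_nat_recr m.+1)//=.
set S := \sum_(0 <= i < _) y i; set T := \sum_(0 <= i < _) f _.
have m2 : (0 : R) < m.+2%:R by rewrite ltr0n.
have m1 : (0 : R) < m.+1%:R by rewrite ltr0n.
have e1 : 1 - m.+2%:R^-1 = m.+1%:R / m.+2%:R :> R.
  by apply: (mulIf (lt0r_neq0 m2)); rewrite mulfVK ?gt_eqF// mulrBl mulVf ?gt_eqF// mul1r
    -natr1 addrK.
have t1 : m.+2%:R^-1 <= 1 :> R by rewrite invf_le1// ler1n.
have := convex_ineq f_convex (y m.+1) (m.+1%:R^-1 *: S) (ltW (divr_gt0 ltr01 m2)).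
rewrite div1r e1 => /(_ t1) Hc.
rewrite [S + _]addrC scalerDr [T + _]addrC mulrDr.
have -> : m.+2%:R^-1 *: S = (m.+1%:R / m.+2%:R) *: (m.+1%:R^-1 *: S).
  by rewrite scalerA mulrAC divff ?gt_eqF// mul1r.
apply: (le_trans Hc); rewrite lerD2l.
rewrite [m.+1%:R / _]mulrC -mulrA ler_pM2l ?invr_gt0//.
by rewrite mulrC -ler_pdivlMr// mulrC.
Qed.

Lemma convex_axis (R : realType) (n : nat) (f : 'rV[R]_n -> R)
    (f_convex : convex_function (setT : set (convex_lmodType 'rV[R]_n)) f)
    (x e : 'rV[R]_n) (t : R) : `|t| <= 1 ->
  f (x + t *: e) - f x <= `|t| * (`|f (x + e) - f x| + `|f (x - e) - f x|).
Proof.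
have base (u : R) (v : 'rV[R]_n) : 0 <= u -> u <= 1 ->
    f (x + u *: v) - f x <= u * `|f (x + v) - f x|.
  move=> u0 u1.
  have := convex_ineq f_convex (x + v) x u0 u1.
  rewrite scalerDr addrAC -scalerDl addrC addrCA subrr addr0 scale1r => h.
  apply: (@le_trans _ _ (u * (f (x + v) - f x))); last first.
    by rewrite ler_wpM2l// ler_norm.
  by rewrite [_ + x]addrC in h; lra.
move=> t1; have [t0|t0] := leP 0 t.
  rewrite ger0_norm// in t1 *.
  apply: (le_trans (base t e t0 t1)).
  by rewrite ler_wpM2l// lerDl.
rewrite ltr0_norm// in t1 *.
have := base (- t) (- e) _ t1; rewrite scalerN scaleNr opprK => h.
apply: (le_trans (h _)); first by lra.
by rewrite ler_wpM2l ?lerDr// oppr_ge0 ltW.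
Qed.

(** A perturbation [v] is the mean over the coordinates [i] of the vectors
    [n * v_i * e_i], so the bounds along the axes control [f] near [x]. *)
Lemma convex_upper_bound (R : realType) (n : nat) (f : 'rV[R]_n -> R)
    (f_convex : convex_function (setT : set (convex_lmodType 'rV[R]_n)) f)
    (x : 'rV[R]_n) :
  exists2 C : R, 0 <= C & forall v : 'rV[R]_n, n%:R * `|v| <= 1 ->
    f (x + v) - f x <= C * `|v|.
Proof.
case: n f f_convex x => [|n] f f_convex x.
  by exists 0 => // v _; rewrite [v]thinmx0 addr0 subrr mul0r.
pose e i : 'rV[R]_n.+1 := delta_mx 0 i.
pose c i := `|f (x + e i) - f x| + `|f (x - e i) - f x|.
exists (\sum_i c i); first by apply: sumr_ge0 => i _; rewrite addr_ge0.
move=> v v1.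
pose y (i : nat) := x + n.+1%:R *: (v 0 (inord i) *: e (inord i)).
have m0 : (0 : R) < n.+1%:R by rewrite ltr0n.
have -> : x + v = n.+1%:R^-1 *: \sum_(0 <= i < n.+1) y i.
  rewrite big_mkord big_split /= sumr_const card_ord -scaler_sumr.
  rewrite scalerDr -[x *+ _]scaler_nat !scalerK ?gt_eqF//.
  congr (_ + _); rewrite {1}[v]row_sum_delta.
  by apply: eq_bigr => i _; rewrite inord_val.
have h := convex_mean n f_convex y.
rewrite lerBlDr (le_trans h)// mulrC ler_pdivrMr// big_mkord.
rewrite (@le_trans _ _ (\sum_(i < n.+1) (f x + n.+1%:R * `|v| * c i)))//.
  apply: ler_sum => i _; rewrite /y inord_val scalerA -lerBlDl.
  have vi : `|n.+1%:R * v 0 i| <= n.+1%:R * `|v|.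
    by rewrite normrM ger0_norm ?ler0n// ler_wpM2l ?ler0n// coord_le_norm.
  apply: le_trans (convex_axis f_convex x (e i) (le_trans vi v1)) _.
  by rewrite ler_wpM2r// addr_ge0.
rewrite big_split /= sumr_const card_ord -mulr_sumr -[f x *+ _]mulr_natl.
by rewrite le_eqVlt; apply/orP; left; apply/eqP; ring.
Qed.

Lemma convex_continuous (R : realType) (n : nat) (f : 'rV[R]_n -> R)
    (f_convex : convex_function (setT : set (convex_lmodType 'rV[R]_n)) f) :
  continuous f.
Proof.
move=> x; have [C C0 HC] := convex_upper_bound f_convex x.
apply/(@cvgrPdist_le R R^o 'rV[R]_n (nbhs x) _ f (f x)) => e e0.
have d0 : 0 < Num.min (n%:R + 1)^-1 (e / (C + 1)).
  rewrite lt_min invr_gt0 divr_gt0 ?ltr_wpDl ?ler0n//.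
near=> y.
have yd : `|y - x| <= Num.min (n%:R + 1)^-1 (e / (C + 1)).
  by rewrite distrC; near: y; exact: cvgr_dist_le.
move: yd; rewrite le_min => /andP[yn ye].
have n1 : n%:R * `|y - x| <= 1.
  move: yn; rewrite -[_^-1]mul1r ler_pdivlMr ?ltr_wpDl ?ler0n//.
  by apply: le_trans; rewrite mulrC ler_wpM2l// lerDl.
have eC : C * `|y - x| <= e.
  move: ye; rewrite ler_pdivlMr ?ltr_wpDl//.
  by apply: le_trans; rewrite mulrC ler_wpM2l// lerDl.
(* the lower bound comes from the upper one at the point symmetric to [y] *)
have h1 := HC _ n1.
have h2 := HC (- (y - x)); rewrite normrN in h2; have {}h2 := h2 n1.
have half0 : (0 : R) <= 2^-1 by rewrite invr_ge0.
have half1 : (2^-1 : R) <= 1 by rewrite invf_le1// ler1n.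
have := convex_ineq f_convex (x + (y - x)) (x + - (y - x)) half0 half1.
have -> : 1 - 2^-1 = 2^-1 :> R by lra.
rewrite -scalerDr addrACA subrr addr0 -[x + x]mulr2n -[x *+ 2]scaler_nat scalerA mulVf//.
rewrite scale1r => h3.
have xy : x + (y - x) = y by rewrite addrC subrK.
by rewrite xy in h1 h3; rewrite ler_distl; apply/andP; split; lra.
Unshelve. all: by end_near. Qed.

(** * Clarke derivative and subdifferential of a convex function *)

Lemma cvg_ray (R : realType) (n : nat) (f : 'rV[R]_n -> R) (t : R)
    (T : Type) (F : set_system T) {FF : Filter F} (u v : T -> 'rV[R]_n)
    (a b : 'rV[R]_n) :
  continuous f -> u @ F --> a -> v @ F --> b ->
  f (u x + t *: v x) @[x --> F] --> f (a + t *: b).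
Proof.
move=> fc ua vb; apply: (cvg_comp (fun x => u x + t *: v x) f); last exact: fc.
by apply: cvgD => //; apply: cvgZ => //; exact: cvg_cst.
Qed.

Lemma convex_slope_le (R : realType) (n : nat) (f : 'rV[R]_n -> R)
    (f_convex : convex_function (setT : set (convex_lmodType 'rV[R]_n)) f)
    (y d : 'rV[R]_n) (s t : R) : 0 < s -> s <= t ->
  (f (y + s *: d) - f y) / s <= (f (y + t *: d) - f y) / t.
Proof.
move=> s0 st; have t0 := lt_le_trans s0 st.
have u0 : 0 <= s / t by rewrite divr_ge0 ?ltW.
have u1 : s / t <= 1 by rewrite ler_pdivrMr// mul1r.
have := convex_ineq f_convex (y + t *: d) y u0 u1.
rewrite scalerDr addrAC -scalerDl subrKC scale1r scalerA divfK ?gt_eqF// => h.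
rewrite ler_pdivrMr// mulrAC -mulrA [_ * (s / t)]mulrC.
by apply: (@le_trans _ _ (s / t * f (y + t *: d) + (1 - s / t) * f y - f y)); lra.
Qed.

(** The slope for the step [t] is continuous in the base point, and bounds from
    above all the slopes for smaller steps. *)
Lemma clarke_le_slope (R : realType) (n : nat) (f : 'rV[R]_n -> R)
    (f_convex : convex_function (setT : set (convex_lmodType 'rV[R]_n)) f)
    (x d : 'rV[R]_n) (t : R) : 0 < t ->
  (clarke_derivative f x d <= ((f (x + t *: d) - f x) / t)%:E)%E.
Proof.
move=> t0; apply/lee_addgt0Pr => e e0.
have fc := convex_continuous f_convex.
pose q y := (f (y + t *: d) - f y) / t.
have qc : q y @[y --> x] --> q x.
  apply: (@cvgM R 'rV[R]_n (nbhs x)); last exact: cvg_cst.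
  apply: (@cvgB R R^o 'rV[R]_n (nbhs x)); last exact: fc.
  by apply: (cvg_ray (F := nbhs x)) => //; exact: cvg_cst.
have near_q : \forall y \near x, q y <= q x + e.
  by apply: (cvgr_le _ qc); rewrite ltrDl.
apply: (@le_trans _ _ (ereal_sup [set ((f (yt.1 + yt.2 *: d) - f yt.1) / yt.2)%:E |
  yt in [set y | q y <= q x + e] `*` [set s : R | 0 < s /\ s <= t]])).
  apply: ereal_inf_lbound; eexists; last by reflexivity.
  exists ([set y | q y <= q x + e], [set s : R | 0 < s /\ s <= t]) => //=.
  split => //; near=> s; split; first by near: s; exact: nbhs_right_gt.
  by near: s; exact: nbhs_right_le.
apply: ge_ereal_sup => _ [[y s] /= [qy [s0 st]] <-].
rewrite -EFinD lee_fin; apply: le_trans qy.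
exact: convex_slope_le.
Unshelve. all: by end_near. Qed.

Lemma clarke_ge (R : realType) (n : nat) (f : 'rV[R]_n -> R)
    (x d : 'rV[R]_n) (a : R) :
  (forall t, 0 < t -> a <= (f (x + t *: d) - f x) / t) ->
  (a%:E <= clarke_derivative f x d)%E.
Proof.
move=> ha; apply: le_ereal_inf_tmp => _ [V [[A B] /= [Ax B0] ABV] <-].
have [t [Bt t0]] : exists t : R, B t /\ 0 < t.
  have : at_right (0 : R) (B `&` [set t | 0 < t]).
    by apply: filterI => //; exact: nbhs_right_gt.
  by move=> /filter_ex[t [Bt t0]]; exists t.
apply: (@le_trans _ _ ((f (x + t *: d) - f x) / t)%:E); first by rewrite lee_fin ha.
by apply: ereal_sup_ubound; exists (x, t) => //; apply: ABV; split => //;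
  exact: nbhs_singleton.
Qed.

Lemma clarke_ge0P (R : realType) (n : nat) (f : 'rV[R]_n -> R)
    (f_convex : convex_function (setT : set (convex_lmodType 'rV[R]_n)) f)
    (x d : 'rV[R]_n) :
  (0 <= clarke_derivative f x d)%E <-> (forall t, 0 < t -> f x <= f (x + t *: d)).
Proof.
split => [h t t0|h].
  have := le_trans h (clarke_le_slope f_convex x d t0).
  by rewrite lee_fin pmulr_lge0 ?invr_gt0// subr_ge0.
by apply: clarke_ge => t t0; rewrite divr_ge0 ?subr_ge0 ?h// ltW.
Qed.

Lemma clarke_subdifferentialP (R : realType) (n : nat) (f : 'rV[R]_n -> R)
    (f_convex : convex_function (setT : set (convex_lmodType 'rV[R]_n)) f)
    (x g : 'rV[R]_n) :
  clarke_subdifferential f x g <-> (forall y, f x + dotv g (y - x) <= f y).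
Proof.
split => [h y|h d].
  have := le_trans (h (y - x)) (clarke_le_slope f_convex x (y - x) ltr01).
  by rewrite lee_fin scale1r divr1 [x + _]addrC subrK lerBrDl.
apply: clarke_ge => t t0; rewrite ler_pdivlMr// lerBrDl mulrC -dotvZr.
by have := h (x + t *: d); rewrite [x + _]addrC addrK.
Qed.

Lemma stationaryP (R : realType) (n : nat) (f : 'rV[R]_n -> R)
    (f_convex : convex_function (setT : set (convex_lmodType 'rV[R]_n)) f)
    (x : 'rV[R]_n) :
  stationary f x <-> (forall y, f x <= f y).
Proof.
split => [/(clarke_subdifferentialP f_convex)h y|h].
  by have := h y; rewrite dot0v addr0.
by apply/(clarke_subdifferentialP f_convex) => y; rewrite dot0v addr0.
Qed.

Lemma minimizersP (R : realType) (n : nat) (f : 'rV[R]_n -> R) (x : 'rV[R]_n) :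
  minimizers f x <-> (forall y, f x <= f y).
Proof.
split => [h y|h].
  by rewrite -lee_fin h; apply: ereal_inf_lbound; exists y.
rewrite /minimizers /=; apply/eqP; rewrite eq_le; apply/andP; split.
  by apply: le_ereal_inf_tmp => _ [y _ <-]; rewrite lee_fin.
by apply: ereal_inf_lbound; exists x.
Qed.

(** * Lower semicontinuity and positivity of the optimality measures *)

(** If the infimum at [x] exceeds [b], no point of the compact ball of radius
    [b] lies in the section of [G] at [x]; as [G] is closed, this remains true
    for the sections at the points near [x]. *)
Lemma lsc_inf_enorm_section (R : realType) (n : nat) (G : set ('rV[R]_n * 'rV[R]_n)) :
  closed G ->
  lower_semicontinuous (fun x => ereal_inf [set (enorm g)%:E | g in [set g | G (x, g)]]).
Proof.
move=> Gc x a ha.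
have [b ab bphi] : exists2 b : R, a < b &
    (b%:E < ereal_inf [set (enorm g)%:E | g in [set g | G (x, g)]])%E.
  case: (ereal_inf _) ha => [r| |] //; last by exists (a + 1); rewrite ?ltrDl ?ltry.
  by rewrite lte_fin => ar; exists ((a + r) / 2); rewrite ?lte_fin midf_lt.
pose K := [set g : 'rV[R]_n | enorm g <= b].
have Kco : compact K.
  apply: bounded_closed_compact.
    exists b; split; first by rewrite num_real.
    by move=> M bM g /= gb; rewrite (le_trans (norm_le_enorm g))// (le_trans gb)// ltW.
  apply: (preimage_closed _ (@closed_le _ b)) => g _; exact: enorm_continuous.
have nearK : \near x, K `<=` (fun g => ~ G (x, g)).
  apply: ((compact_near_coveringP K).1 Kco _ (nbhs x) (fun x g => ~ G (x, g))) => g Kg.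
  have nG : ~ G (x, g).
    move=> Gxg; have : (b%:E < (enorm g)%:E)%E.
      by apply: (lt_le_trans bphi); apply: ereal_inf_lbound; exists g.
    by rewrite lte_fin ltNge Kg.
  have := Gc; rewrite -openC openE => /(_ (x, g) nG) [[A B] /= [Ax Bg] AB].
  exists (B, A) => // -[g' x'] [/= Bg' Ax']; exact: (AB (x', g')).
exists [set y | K `<=` (fun g => ~ G (y, g))] => // y Ky.
apply: (@lt_le_trans _ _ b%:E); first by rewrite lte_fin.
apply: le_ereal_inf_tmp => _ [g Gg <-]; rewrite lee_fin leNgt.
by apply/negP => /ltW gb; exact: (Ky g gb Gg).
Qed.

Lemma lsc_gap_subdifferential (R : realType) (n : nat) (f : 'rV[R]_n -> R)
    (f_convex : convex_function (setT : set (convex_lmodType 'rV[R]_n)) f) :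
  lower_semicontinuous (fun x => gap [set 0%R] (clarke_subdifferential f x)).
Proof.
pose G := [set xg : 'rV[R]_n * 'rV[R]_n | clarke_subdifferential f xg.1 xg.2].
suff Gc : closed G.
  rewrite (_ : (fun x => _) = (fun x => ereal_inf
     [set (enorm g)%:E | g in [set g | G (x, g)]])); first exact: lsc_inf_enorm_section.
  apply/funext => x; congr ereal_inf; apply/seteqP; split => z.
    by move=> [[_ g] [/= -> Gg] <-]; exists g => //; rewrite sub0r enormN.
  by move=> [g Gg <-]; exists (0, g) => //=; rewrite sub0r enormN.
have fc := convex_continuous f_convex.
have -> : G = \bigcap_(y in [set: 'rV[R]_n])
    [set xg | 0 <= f y - (f xg.1 + dotv xg.2 (y - xg.1))].
  apply/seteqP; split => xg.
    by move=> /(clarke_subdifferentialP f_convex) h y _ /=; rewrite subr_ge0.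
  move=> h; apply/(clarke_subdifferentialP f_convex) => y.
  by rewrite -subr_ge0; exact: h.
apply: closed_bigI => y _.
apply: (@preimage_closed _ _ (fun xg : 'rV[R]_n * 'rV[R]_n =>
  f y - (f xg.1 + dotv xg.2 (y - xg.1))) [set z | 0 <= z]); last exact: closed_ge.
move=> [x g] _.
apply: cvgB; first exact: cvg_cst.
apply: cvgD; first by apply: (cvg_comp fst f); [exact: cvg_fst | exact: fc].
apply: cvg_dotv; first exact: cvg_snd.
by apply: cvgB; [exact: cvg_cst | exact: cvg_fst].
Qed.

Lemma lsc_gap_minimizers (R : realType) (n : nat) (f : 'rV[R]_n -> R) :
  continuous f ->
  lower_semicontinuous (fun x => gap [set x] (minimizers f)).
Proof.
move=> fc.
pose G := [set xg : 'rV[R]_n * 'rV[R]_n | minimizers f (xg.1 - xg.2)].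
suff Gc : closed G.
  rewrite (_ : (fun x => _) = (fun x => ereal_inf
     [set (enorm g)%:E | g in [set g | G (x, g)]])); first exact: lsc_inf_enorm_section.
  apply/funext => x; congr ereal_inf; apply/seteqP; split => z.
    move=> [[_ s] [/= -> ms] <-]; exists (x - s) => //=.
    by rewrite /G /= subKr.
  by move=> [g Gg <-]; exists (x, x - g) => //=; rewrite subKr.
have -> : G = \bigcap_(y in [set: 'rV[R]_n])
    [set xg | f (xg.1 + (-1) *: xg.2) <= f y].
  apply/seteqP; split => xg.
    by move=> /minimizersP h y _ /=; rewrite scaleN1r.
  by move=> h; apply/minimizersP => y; have := h y I; rewrite /= scaleN1r.
apply: closed_bigI => y _.
apply: (@preimage_closed _ _ (fun xg : 'rV[R]_n * 'rV[R]_n =>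
  f (xg.1 + (-1) *: xg.2)) [set z | z <= f y]); last exact: closed_le.
move=> [x g] _.
by apply: cvg_ray => //; [exact: cvg_fst | exact: cvg_snd].
Qed.

Lemma lsc_optimality_gap (R : realType) (n : nat) (f : 'rV[R]_n -> R) :
  continuous f -> lower_semicontinuous (fun x => (f x)%:E - infimum f)%E.
Proof.
move=> fc x a; have : (infimum f <= (f x)%:E)%E by apply: ereal_inf_lbound; exists x.
case: (infimum f) => [m _|//|_ _].
  rewrite -EFinB lte_fin ltrBrDr => ha.
  exists [set y | a + m < f y]; first by apply: (cvgr_gt _ (fc x)).
  by move=> y /= hy; rewrite -EFinB lte_fin ltrBrDr.
by exists setT => [|y _]; [exact: filterT | rewrite /= ltry].
Qed.

Lemma gap_point_gt0 (R : realType) (n : nat) (x : 'rV[R]_n) (S : set 'rV[R]_n) :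
  (\forall s \near x, ~ S s) -> (0 < gap [set x] S)%E.
Proof.
move=> /nbhs_ballP[e /= e0 eS].
apply: (@lt_le_trans _ _ e%:E); first by rewrite lte_fin.
apply: le_ereal_inf_tmp => _ [[y s] /= [-> Ss] <-]; rewrite lee_fin.
apply: le_trans (norm_le_enorm _); rewrite leNgt; apply/negP => h.
by apply: (eS s) => //; rewrite -ball_normE.
Qed.

Lemma optimality_gap_gt0 (R : realType) (n : nat) (f : 'rV[R]_n -> R)
    (x y : 'rV[R]_n) : f y < f x -> (0 < (f x)%:E - infimum f)%E.
Proof.
move=> fyx; have : (infimum f <= (f y)%:E)%E by apply: ereal_inf_lbound; exists y.
case: (infimum f) => [m|//|_]; last by rewrite /= ltry.
by rewrite lee_fin -EFinB lte_fin subr_gt0 => /le_lt_trans; apply.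
Qed.

Lemma gap_minimizers_gt0 (R : realType) (n : nat) (f : 'rV[R]_n -> R)
    (x y : 'rV[R]_n) : continuous f -> f y < f x ->
  (0 < gap [set x] (minimizers f))%E.
Proof.
move=> fc fyx; apply: gap_point_gt0.
have : \forall s \near x, f y < f s by apply: (cvgr_gt _ (fc x)).
by apply: filterS => s fys /minimizersP/(_ y); rewrite leNgt fys.
Qed.

Lemma gap_subdifferential_gt0 (R : realType) (n : nat) (f : 'rV[R]_n -> R)
    (f_convex : convex_function (setT : set (convex_lmodType 'rV[R]_n)) f)
    (x y : 'rV[R]_n) : f y < f x ->
  (0 < gap [set 0%R] (clarke_subdifferential f x))%E.
Proof.
move=> fyx; apply: gap_point_gt0.
have dc : dotv g (y - x) @[g --> (0 : 'rV[R]_n)] --> dotv 0 (y - x).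
  by apply: (cvg_dotv (F := nbhs (0 : 'rV[R]_n))); [exact: cvg_id | exact: cvg_cst].
have : \forall g \near (0 : 'rV[R]_n), f y - f x < dotv g (y - x).
  by apply: (cvgr_gt _ dc); rewrite dot0v subr_lt0.
apply: filterS => g hg /(clarke_subdifferentialP f_convex)/(_ y).
by rewrite leNgt -ltrBlDl hg.
Qed.

(** * Measurability of the ascent event *)

Lemma rat_dense_rV (R : realType) (n : nat) (x : 'rV[R]_n) (e : R) : 0 < e ->
  exists q : 'rV[rat]_n, `|x - map_mx ratr q| < e.
Proof.
move=> e0.
have H (i : 'I_n) : exists q : rat, `|x 0 i - ratr q| < e.
  have := @rat_in_itvoo R (x 0 i - e) (x 0 i + e).
  rewrite ltrD2l gtrN// => /(_ isT)[q]; rewrite in_itv /= => /andP[q1 q2].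
  by exists q; rewrite distrC ltr_distl q1 q2.
have [q Hq] := choice H.
exists (\row_i q i).
rewrite /Num.Def.normr /= mx_normrE; apply/bigmax_ltP; split => // -[i j] _ /=.
by rewrite (ord1 i) !mxE.
Qed.

(** [W] is a union of products of balls with rational centers and radii
    [1 / (j + 1)]; there are countably many of those. *)
Lemma measurable_open_pair (R : realType) (n : nat) (d : measure_display)
    (T : measurableType d) (g h : T -> 'rV[R]_n)
    (W : set ('rV[R]_n * 'rV[R]_n)) :
  measurable_fun setT (g : T -> borel 'rV[R]_n) ->
  measurable_fun setT (h : T -> borel 'rV[R]_n) ->
  open W -> measurable [set w | W (g w, h w)].
Proof.
move=> mg mh oW.
pose box (i : 'rV[rat]_n * 'rV[rat]_n * nat) : set ('rV[R]_n * 'rV[R]_n) :=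
  ball (map_mx ratr i.1.1 : 'rV[R]_n) i.2.+1%:R^-1 `*`
  ball (map_mx ratr i.1.2 : 'rV[R]_n) i.2.+1%:R^-1.
have mball (u : T -> 'rV[R]_n) (c : 'rV[R]_n) (r : R) :
    measurable_fun setT (u : T -> borel 'rV[R]_n) -> measurable (u @^-1` ball c r).
  move=> mu; rewrite -[X in measurable X]setTI; apply: mu => //.
  by apply: sub_sigma_algebra; exact: ball_open.
rewrite (_ : [set w | _] = \bigcup_i (if `[< box i `<=` W >] then
    g @^-1` ball (map_mx ratr i.1.1 : 'rV[R]_n) i.2.+1%:R^-1 `&`
    h @^-1` ball (map_mx ratr i.1.2 : 'rV[R]_n) i.2.+1%:R^-1 else set0)); last first.
  apply/seteqP; split => w /=; last first.
    by move=> [i _]; case: ifP => // /asboolP iW [gi hi]; apply: iW.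
  move=> Wgh; have := oW; rewrite openE => /(_ _ Wgh) [[A B] /= [gA hB] AB].
  have /nbhs_ballP[e1 /= e10 eA] := gA.
  have /nbhs_ballP[e2 /= e20 eB] := hB.
  have e0 : 0 < Num.min e1 e2 / 2 by rewrite divr_gt0 ?lt_min ?e10.
  have [j _ /(_ _ (leqnn j)) je] := near_infty_natSinv_lt (PosNum e0).
  have j0 : (0 : R) < j.+1%:R^-1 by rewrite invr_gt0.
  have [q1 Hq1] := rat_dense_rV (g w) j0.
  have [q2 Hq2] := rat_dense_rV (h w) j0.
  exists (q1, q2, j) => //; rewrite ifT /=.
    by split; rewrite -ball_normE /= distrC.
  apply/asboolP.
  move=> [x y] /= [bx by_]; apply: AB; split => /=.
    apply: eA; move: bx; rewrite -!ball_normE /= => bx.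
    rewrite (le_lt_trans (ler_distD (map_mx ratr q1) _ _))//.
    rewrite (lt_le_trans (ltrD Hq1 bx))// (le_trans (ltW (ltrD je je)))//=.
    by rewrite -splitr ge_min lexx.
  apply: eB; move: by_; rewrite -!ball_normE /= => by_.
  rewrite (le_lt_trans (ler_distD (map_mx ratr q2) _ _))//.
  rewrite (lt_le_trans (ltrD Hq2 by_))// (le_trans (ltW (ltrD je je)))//=.
  by rewrite -splitr ge_min lexx orbT.
apply: countable_bigcupT_measurable => [|i]; first exact: countableP.
case: ifP => // _.
by apply: measurableI; exact: mball.
Qed.

Lemma bigmin_ge0P (R : realType) (T : eqType) (s : seq T) (F : T -> \bar R) :
  (0 <= \big[Order.min/+oo%E]_(x <- s) F x)%E <-> (forall x, x \in s -> (0 <= F x)%E).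
Proof.
elim: s => [|a s IH]; first by rewrite big_nil; split => // _; exact: leey.
rewrite big_cons le_min; split => [/andP[a0 /IH h] x|h].
  by rewrite inE => /predU1P[->//|/h].
rewrite h ?mem_head//=; apply/IH => x xs; apply: h.
by rewrite inE xs orbT.
Qed.

(** By convexity, the ascent condition on a direction can be tested on the
    steps [1 / (m + 1)] only. Measurability matters because a measure is monotone on
    measurable sets only. *)
Lemma measurable_ascent_event (R : realType) (n : nat) (f : 'rV[R]_n -> R)
    (f_convex : convex_function (setT : set (convex_lmodType 'rV[R]_n)) f)
    (d : measure_display) (T : measurableType d)
    (D : T -> seq 'rV[R]_n) (X : T -> 'rV[R]_n) :
  random_directions D -> measurable_fun setT (X : T -> borel 'rV[R]_n) ->
  measurable (ascent_event f D X).
Proof.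
move=> [mD mDi] mX.
pose W (m : nat) := [set xd : 'rV[R]_n * 'rV[R]_n | f (xd.1 + m.+1%:R^-1 *: xd.2) < f xd.1].
have oW m : open (W m).
  have -> : W m = (fun xd => f xd.1 - f (xd.1 + m.+1%:R^-1 *: xd.2)) @^-1` [set z | 0 < z].
    by apply/seteqP; split => xd; rewrite /W /= subr_gt0.
  apply: open_comp; last exact: open_gt.
  move=> [x v] _; have fc := convex_continuous f_convex.
  apply: cvgB; first by apply: (cvg_comp fst f); [exact: cvg_fst | exact: fc].
  by apply: cvg_ray => //; [exact: cvg_fst | exact: cvg_snd].
have -> : ascent_event f D X = \bigcap_i \bigcap_m
    (~` ([set w | (i < size (D w))%N] `&` [set w | W m (X w, nth 0 (D w) i)])).
  apply/seteqP; split => w.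
    move=> /bigmin_ge0P h i _ m _ [/= iD].
    have /(clarke_ge0P f_convex) := h _ (mem_nth 0 iD).
    by move=> /(_ m.+1%:R^-1); rewrite invr_gt0 ltr0n /W /= leNgt => /(_ isT)/negP.
  move=> h; apply/bigmin_ge0P => v vD.
  have hm (m : nat) : f (X w) <= f (X w + m.+1%:R^-1 *: v).
    rewrite leNgt; apply/negP => hlt.
    apply: (h (index v (D w)) I m I); split; first by rewrite /= index_mem.
    by rewrite /W /= nth_index.
  apply/(clarke_ge0P f_convex) => t t0.
  have [m _ /(_ _ (leqnn m)) mt] := near_infty_natSinv_lt (PosNum t0).
  have m0 : (0 : R) < m.+1%:R^-1 by rewrite invr_gt0.
  have := convex_slope_le f_convex (X w) v m0 (ltW mt) => /= hs.
  have : 0 <= (f (X w + t *: v) - f (X w)) / t.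
    by apply: le_trans hs; rewrite divr_ge0 ?subr_ge0.
  by rewrite pmulr_lge0 ?invr_gt0// subr_ge0.
apply: bigcap_measurableType => i _; apply: bigcap_measurableType => m _.
apply: measurableC; apply: measurableI.
  have := mD measurableT [set k | (i < k)%N] I; by rewrite setTI.
exact: measurable_open_pair.
Qed.

(** * The filtration generated by the algorithm *)

Section process_past.
Context (R : realType) (n : nat) (disp : measure_display)
  (Omega : measurableType disp).
Context (D : nat -> Omega -> seq 'rV[R]_n) (X : nat -> Omega -> 'rV[R]_n).
Hypothesis mD : forall k, random_directions (D k).
Hypothesis mX : forall k, measurable_fun setT (X k : Omega -> borel 'rV[R]_n).

Lemma past_sigma_algebra k : sigma_algebra setT (past D X k).
Proof. exact: smallest_sigma_algebra. Qed.

Lemma past_measurable k : past D X k `<=` measurable.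
Proof.
apply: smallest_sub; first exact: sigma_algebra_measurable.
move=> H [j _ [|[B mB <-]]]; last exact: mX.
apply: smallest_sub; first exact: sigma_algebra_measurable.
move=> {}H [[B mB <-]|[i _ [B mB <-]]].
  exact: (mD j).1.
exact: (mD j).2.
Qed.

Lemma past_mono j k : (j <= k)%N -> past D X j `<=` past D X k.
Proof.
move=> jk; apply: sub_sigma_algebra2 => H [i /= ij HH].
by exists i => //=; exact: leq_trans ij jk.
Qed.

Lemma past_iterate (x0 : 'rV[R]_n) j k (B : set 'rV[R]_n) :
  (forall w, X 0 w = x0) -> (j <= k)%N ->
  measurable (B : set (borel 'rV[R]_n)) -> past D X k (X j @^-1` B).
Proof.
move=> X0 jk mB; apply: (past_mono jk); case: j {jk} => [|j].
  have [p0 pC _] := past_sigma_algebra 0.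
  have [Bx|Bx] := pselect (B x0).
    rewrite (_ : _ @^-1` _ = setT `\` set0); first exact: pC.
    by rewrite setD0; apply/seteqP; split => w //= _; rewrite X0.
  rewrite (_ : _ @^-1` _ = set0); first exact: p0.
  by apply/seteqP; split => w //=; rewrite X0.
apply: sub_sigma_algebra; exists j => //=; right; exists B => //.
by rewrite setTI.
Qed.

Lemma past_stay (x0 : 'rV[R]_n) k :
  (forall w, X 0 w = x0) -> past D X k.+1 [set w | X k.+1 w = X k w].
Proof.
move=> X0.
rewrite (_ : [set w | _] = ~` [set w | [set xy | xy.1 != xy.2] (X k.+1 w, X k w)]); last first.
  by apply/seteqP; split => w /=; [move=> ->; rewrite eqxx | move/negP; rewrite negbK => /eqP].
have [_ pC _] := past_sigma_algebra k.+1; rewrite -setTD; apply: pC.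
pose G := \bigcup_(j in [set j | (j < k.+1)%N])
        (directions_sigma (D j) `|`
         g_sigma_algebra_preimage (X j.+1 : Omega -> borel 'rV[R]_n)).
have mXG j : (j <= k.+1)%N ->
    measurable_fun setT (X j : g_sigma_algebraType G -> borel 'rV[R]_n).
  by move=> jk _ B mB; rewrite setTI; exact: (past_iterate X0).
apply: (@measurable_open_pair R n _ (g_sigma_algebraType G)); [exact: mXG..|].
have -> : [set xy : 'rV[R]_n * 'rV[R]_n | xy.1 != xy.2] =
    (fun xy => `|xy.1 - xy.2|) @^-1` [set z | 0 < z].
  by apply/seteqP; split => -[x y] /=; rewrite normr_gt0 subr_eq0.
apply: open_comp; last exact: open_gt.
by move=> xy _; apply: cvg_norm; apply: cvgB; [exact: cvg_fst | exact: cvg_snd].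
Qed.

End process_past.

Lemma conditional_probability_ge (R : realType) (disp : measure_display)
    (Omega : measurableType disp) (P : probability Omega R)
    (G : set (set Omega)) (E H : set Omega)
    (Z : Omega -> R) (p : R) : 0 <= p ->
  G `<=` measurable -> conditional_probability P G E Z ->
  {ae P, forall w, p <= Z w} -> G H -> (p%:E * P H <= P (E `&` H))%E.
Proof.
move=> p0 Gm [_ Zi HZ] pZ GH; rewrite -HZ//.
have mH := Gm _ GH.
have mZ : measurable_fun H (fun w => (Z w)%:E).
  by apply: measurable_funS (measurable_int _ Zi).
have mM : measurable_fun H (fun w => maxe p%:E (Z w)%:E).
  by apply: measurable_maxe => //; exact: measurable_cst.
rewrite -(integral_cst P mH).
(* [Z] may be negative on a null set: compare [p] with [maxe p Z] instead *)
have -> : (\int[P]_(w in H) (Z w)%:E = \int[P]_(w in H) maxe p%:E (Z w)%:E)%E.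
  apply: ae_eq_integral => //.
  by apply: filterS pZ => w pZw _; apply/esym/max_idPr; rewrite lee_fin.
apply: ge0_le_integral => //.
by move=> w _; rewrite le_max; apply/orP; left; rewrite lee_fin.
Qed.

(** * Multiplicative random walks with negative drift *)

(** The expression equals [1] at [s = 0], where its derivative
    [p * ln theta + (1 - p) * ln gamma] is negative. *)
Lemma powR_drift_lt1 (R : realType) (theta gamma p : R) : 0 < theta -> theta < 1 ->
  1 <= gamma -> 0 <= p -> p <= 1 -> p_star theta gamma < p ->
  exists2 s : R, 0 < s & p * theta `^ s + (1 - p) * gamma `^ s < 1.
Proof.
move=> t0 t1 g1 p0 p1; have g0 := lt_le_trans ltr01 g1.
rewrite /p_star lnM ?posrE ?invr_gt0// lnV ?posrE//.
have a0 : 0 < - ln theta by rewrite oppr_gt0 ln_lt0// t0.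
have b0 := ln_ge0 g1.
set a := - ln theta in a0 *; set b := ln gamma in b0 *.
rewrite ltr_pdivrMr ?ltr_wpDr// => hp.
have dlt : 0 < p * (a + b) - b by rewrite subr_gt0.
set del := p * (a + b) - b in dlt.
have ab0 : 0 < (1 + a) * (1 + b) by rewrite mulr_gt0// ltr_wpDr// ltW.
(* [theta `^ s <= 1 / (1 + s a)] and [gamma `^ s <= 1 / (1 - s b)]; with these
   bounds the claim amounts to [s a b < del], given that [s b < 1] *)
exists (del / ((1 + a) * (1 + b))); first by rewrite divr_gt0.
set s := del / _.
have s0 : 0 < s by rewrite divr_gt0.
have sE : s * ((1 + a) * (1 + b)) = del by rewrite divfK ?gt_eqF.
have sa0 : 0 <= s * a by rewrite mulr_ge0 ?ltW.
have sb0 : 0 <= s * b by rewrite mulr_ge0 // ltW.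
have sab : s * a * b < del by rewrite -sE; nra.
have dela : del <= a by rewrite /del; nra.
have sb1 : s * b < 1.
  rewrite -(ltr_pM2r ab0) mul1r mulrAC sE.
  by apply: (@le_lt_trans _ _ (a * b)); [rewrite ler_wpM2r | nra].
have ht : theta `^ s <= (1 + s * a)^-1.
  rewrite /powR gt_eqF// (_ : s * ln theta = - (s * a)); last by rewrite /a; ring.
  rewrite expRN lef_pV2 ?posrE ?expR_gt0 ?ltr_wpDr//.
  exact: expR_ge1Dx.
have hg : gamma `^ s <= (1 - s * b)^-1.
  have -> : gamma `^ s = (expR (- (s * b)))^-1 by rewrite expRN invrK /powR gt_eqF.
  rewrite lef_pV2 ?posrE ?expR_gt0 ?subr_gt0//.
  exact: expR_ge1Dx.
have sa1 : 0 < 1 + s * a by rewrite ltr_wpDr.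
have sb2 : 0 < 1 - s * b by rewrite subr_gt0.
have q0 : 0 <= 1 - p by rewrite subr_ge0.
apply: (@le_lt_trans _ _ (p * (1 + s * a)^-1 + (1 - p) * (1 - s * b)^-1)).
  by rewrite lerD// ler_wpM2l.
rewrite -(ltr_pM2r (mulr_gt0 sa1 sb2)) mul1r.
have -> : (p * (1 + s * a)^-1 + (1 - p) * (1 - s * b)^-1) * ((1 + s * a) * (1 - s * b))
    = p * (1 - s * b) + (1 - p) * (1 + s * a).
  by field; rewrite !lt0r_neq0.
suff : s * (s * a * b) < s * del by rewrite /del; nra.
by rewrite ltr_pM2l.
Qed.

Lemma half_remains (R : realFieldType) (x u y v : R) :
  x = u + y -> u <= v -> v <= x / 2 -> x <= 2 * y.
Proof. lra. Qed.

(** [a k] is multiplied by [theta] when [B k] occurs and by [gamma] otherwise;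
    [B k] is known at time [k + 1], and has conditional probability at least [p]
    given [F k]. *)
Section random_walk.
Context (R : realType) (disp : measure_display) (Omega : measurableType disp)
  (P : probability Omega R).
Context (F : nat -> set (set Omega)) (B : nat -> set Omega)
  (a : nat -> Omega -> R) (theta gamma p s : R).
Hypothesis Fs : forall k, sigma_algebra setT (F k).
Hypothesis Fm : forall k, F k `<=` measurable.
Hypothesis Fmono : forall k, F k `<=` F k.+1.
Hypothesis FB : forall k, F k.+1 (B k).
Hypothesis PB : forall k H, F k H -> (p%:E * P H <= P (B k `&` H))%E.
Hypothesis ma : forall k, measurable_fun setT (a k).
Hypothesis theta0 : 0 < theta.
Hypothesis theta1 : theta < 1.
Hypothesis gamma1 : 1 <= gamma.
Hypothesis p_gt0 : 0 < p.
Hypothesis p1 : p <= 1.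
Hypothesis aB : forall k w, B k w -> a k.+1 w = theta * a k w.
Hypothesis aNB : forall k w, ~ B k w -> a k.+1 w = gamma * a k w.
Hypothesis s0 : 0 < s.

Let r := p * theta `^ s + (1 - p) * gamma `^ s.
Hypothesis r1 : r < 1.

Let Pr (H : set Omega) : R := fine (P H).

Let PrE H : measurable H -> P H = (Pr H)%:E.
Proof. by move=> mH; rewrite fineK// fin_num_measure. Qed.

Let Pr_ge0 H : 0 <= Pr H.
Proof. by rewrite fine_ge0. Qed.

Let Pr_split H C : measurable H -> measurable C ->
  Pr H = Pr (H `&` C) + Pr (H `&` ~` C).
Proof.
move=> mH mC; apply: EFin_inj.
have m1 : measurable (H `&` C) by apply: measurableI.
have m2 : measurable (H `&` ~` C) by apply: measurableI => //; exact: measurableC.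
by rewrite EFinD -!PrE// (measureDI P mH mC) setDE addeC.
Qed.

Let Pr_mono H C : measurable H -> measurable C -> H `<=` C -> Pr H <= Pr C.
Proof.
by move=> mH mC HC; rewrite -lee_fin -!PrE//; apply: le_measure; rewrite ?inE.
Qed.

Let FI k H C : F k H -> F k C -> F k (H `&` C).
Proof.
move=> FH FC; rewrite -(measurable_g_measurableTypeE (Fs k)).
by apply: measurableI; exact: sub_sigma_algebra.
Qed.

Let FC k H : F k H -> F k (~` H).
Proof. by move=> FH; have [_ h _] := Fs k; rewrite -setTD; exact: h. Qed.

Let m_ge k t : measurable [set w | t <= a k w].
Proof.
have := ma k measurableT (measurable_itv `[t, +oo[ ).
by rewrite setTI; congr measurable; apply/seteqP; split => w /=; rewrite in_itv /= andbT.
Qed.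

Let PrB k H : F k H -> p * Pr H <= Pr (H `&` B k).
Proof.
move=> FH; have mH := Fm FH.
have mHB : measurable (H `&` B k) by apply: measurableI => //; exact: Fm (FB k).
by have := PB FH; rewrite setIC !PrE// -EFinM lee_fin.
Qed.

Let r_gt0 : 0 < r.
Proof.
by rewrite ltr_pwDl ?mulr_gt0 ?powR_gt0// mulr_ge0 ?powR_ge0// subr_ge0.
Qed.

Let r_ge0 : 0 <= r. Proof. exact: ltW. Qed.

(** Induction on [j], splitting [H] by the outcome of the first step: the
    bound [c] on [a m] becomes [theta * c] or [gamma * c]. *)
Lemma step_tail j m H c t : F m H -> (forall w, H w -> a m w <= c) ->
  0 < c -> 0 < t ->
  t `^ s * Pr (H `&` [set w | t <= a (m + j)%N w]) <= r ^+ j * c `^ s * Pr H.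
Proof.
move=> + + + t0; elim: j m H c => [|j IH] m H c FH Hc c0.
  rewrite addn0 expr0 mul1r; have [tc|ct] := leP t c.
    apply: ler_pM => //; first exact: powR_ge0.
      by apply: ge0_ler_powR => //; rewrite ?nnegrE ltW.
    by apply: Pr_mono => //; [apply: measurableI => //; exact: Fm FH | exact: Fm FH].
  rewrite (_ : _ `&` _ = set0).
    by rewrite /Pr measure0 mulr0 mulr_ge0 ?powR_ge0 ?fine_ge0.
  by apply/seteqP; split => // w [/Hc h /= /le_trans/(_ h)]; rewrite leNgt ct.
have mH := Fm FH; have mB := Fm (FB m).
have FHB : F m.+1 (H `&` B m) by apply: FI => //; exact: Fmono.
have FHN : F m.+1 (H `&` ~` B m) by apply: FI; [exact: Fmono | exact: FC].
have g0 := lt_le_trans ltr01 gamma1.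
have hB := IH m.+1 _ (theta * c) FHB _ (mulr_gt0 theta0 c0).
have {}hB := hB _.
have hN := IH m.+1 _ (gamma * c) FHN _ (mulr_gt0 g0 c0).
have {}hN := hN _.
set S := [set w | t <= a (m + j.+1)%N w].
have mS : measurable S by exact: m_ge.
have -> : Pr (H `&` S) = Pr (H `&` B m `&` S) + Pr (H `&` ~` B m `&` S).
  by rewrite [LHS](Pr_split (measurableI _ _ mH mS) mB) setIAC [in X in _ + X]setIAC.
rewrite mulrDr addSnnS -/S in hB hN *.
apply: (le_trans (lerD (hB _) (hN _))).
- by move=> w [/Hc h Bw]; rewrite aB// ler_pM2l.
- by move=> w [/Hc h Bw]; rewrite aNB// ler_pM2l.
have rj : 0 <= r ^+ j * c `^ s.
  by rewrite mulr_ge0 ?powR_ge0 ?exprn_ge0 ?r_ge0.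
rewrite !powRM ?(ltW theta0) ?(ltW g0) ?(ltW c0)// exprSr.
set x := Pr (H `&` B m); set y := Pr (H `&` ~` B m).
have xy : Pr H = x + y := Pr_split mH mB.
have px : p * (x + y) <= x by rewrite -xy; exact: PrB.
have TG : theta `^ s <= gamma `^ s.
  apply: ge0_ler_powR; rewrite ?nnegrE; [exact: ltW..|].
  exact: le_trans (ltW theta1) gamma1.
rewrite xy -subr_ge0.
rewrite (_ : _ - _ = r ^+ j * c `^ s *
  ((gamma `^ s - theta `^ s) * (x - p * (x + y)))); last by rewrite {2}/r; ring.
by apply: mulr_ge0 => //; apply: mulr_ge0; rewrite subr_ge0.
Qed.

(** [q] is such that [q `^ s] is the square root [z] of [r], which makes the
    bounds of [step_tail] at [t = K * q ^+ j * c] sum up to half of the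
    probability of [H]. *)
Lemma walk_decay : exists K q : R, [/\ 0 < K, 0 < q, q < 1 &
  forall m H c, F m H -> (forall w, H w -> a m w <= c) -> 0 < c ->
  exists G : set Omega, [/\ measurable G, G `<=` H,
    (P H <= 2%:E * P G)%E &
    forall w j, G w -> a (m + j)%N w <= K * q ^+ j * c]].
Proof.
pose z := Num.sqrt r.
have z0 : 0 < z by rewrite sqrtr_gt0 r_gt0.
have z1 : z < 1 by rewrite -sqrtr1 ltr_sqrt.
have zr : z ^+ 2 = r by rewrite sqr_sqrtr ?r_ge0.
have s'0 : s^-1 * s = 1 by rewrite mulVf// gt_eqF.
have d0 : 0 < 1 - z by rewrite subr_gt0.
pose K := (2 / (1 - z)) `^ s^-1; pose q := z `^ s^-1.
have K0 : 0 < K by apply: powR_gt0; rewrite divr_gt0.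
have q0 : 0 < q by exact: powR_gt0.
have Ks : K `^ s = 2 / (1 - z) by rewrite -powRrM s'0 powRr1 ?divr_ge0 ?ltW.
have qs : q `^ s = z by rewrite -powRrM s'0 powRr1 ?ltW.
have q1 : q < 1.
  rewrite ltNge; apply/negP => q1; move: z1; rewrite -qs ltNge => /negP; apply.
  have -> : 1 = 1 `^ s :> R by rewrite powR1.
  by apply: ge0_ler_powR => //; rewrite ?nnegrE ltW.
exists K, q; split=> // m H c FH Hc c0.
have mH := Fm FH.
pose T j := K * q ^+ j * c.
have T0 j : 0 < T j by rewrite !mulr_gt0// exprn_gt0.
pose Bad j := H `&` [set w | T j <= a (m + j)%N w].
have mBad j : measurable (Bad j) by apply: measurableI.
have PBad j : Pr (Bad j) <= Pr H * (1 - z) / 2 * z ^+ j.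
  have := step_tail j FH Hc c0 (T0 j).
  rewrite -/(Bad j) /T !powRM ?mulr_ge0 ?exprn_ge0 ?(ltW K0) ?(ltW q0) ?(ltW c0)//.
  rewrite -(powR_mulrn _ (ltW q0)) powRAC powR_mulrn ?powR_ge0// qs Ks -zr -exprM mulnC exprM.
  have cs : 0 < c `^ s by rewrite powR_gt0.
  have zj : 0 < z ^+ j by rewrite exprn_gt0.
  rewrite expr2 (_ : _ * _ * c `^ s * Pr (Bad j) =
    c `^ s * (z ^+ j * (2 / (1 - z) * Pr (Bad j)))); last by ring.
  rewrite (_ : _ * c `^ s * Pr H = c `^ s * (z ^+ j * (z ^+ j * Pr H))); last by ring.
  rewrite !ler_pM2l// mulrAC ler_pdivrMr// mulrC -ler_pdivlMr// => h.
  by rewrite (_ : Pr H * _ / _ * _ = z ^+ j * Pr H * (1 - z) / 2)//; ring.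
pose G := H `\` \bigcup_j Bad j.
have mU : measurable (\bigcup_j Bad j) by exact: bigcupT_measurable.
have mG : measurable G by exact: measurableD.
exists G; split => //.
- by move=> w [].
- have PU : Pr (\bigcup_j Bad j) <= Pr H / 2.
    rewrite -lee_fin -PrE//.
    apply: (le_trans (measure_sigma_subadditive P mBad mU _)) => //.
    apply: lime_le; first by apply: is_cvg_nneseries => *; exact: measure_ge0.
    near=> N; rewrite (eq_bigr (fun j => (Pr (Bad j))%:E)); last first.
      by move=> j _; exact: PrE.
    rewrite sumEFin lee_fin.
    apply: (@le_trans _ _ (series (geometric (Pr H * (1 - z) / 2) z) N)).
      by rewrite /series /=; apply: ler_sum => j _; exact: PBad.
    apply: le_trans (geometric_le_lim _ _ _ _) _ => //.
    + by rewrite !mulr_ge0 ?Pr_ge0 ?ltW.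
    + by rewrite ger0_norm// ltW.
    + by rewrite le_eqVlt; apply/orP; left; apply/eqP; field; rewrite gt_eqF.
  rewrite !PrE// -EFinM lee_fin.
  have := Pr_split mH mU; rewrite -setDE -/G => e.
  have := Pr_mono (measurableI _ _ mH mU) mU (@subIsetr _ H _).
  by move=> h; exact: (half_remains e h PU).
- move=> w j [Hw nB]; rewrite leNgt; apply/negP => h; apply: nB.
  by exists j => //; split => //; exact: ltW.
Unshelve. all: by end_near. Qed.

(** The intersection of [B 0], ..., [B (m - 1)]. *)
Fixpoint first_stays (m : nat) : set Omega :=
  if m is m'.+1 then B m' `&` first_stays m' else setT.

Lemma first_staysF m : F m (first_stays m).
Proof.
elim: m => [|m IH] /=.
  by have [F0 _ _] := Fs 0; rewrite -setC0; exact: FC.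
by apply: FI => //; exact: Fmono.
Qed.

Lemma first_stays_prob m : ((p ^+ m)%:E <= P (first_stays m))%E.
Proof.
elim: m => [|m IH] /=; first by rewrite probability_setT expr0.
apply: le_trans (PB (first_staysF m)).
by rewrite exprS EFinM; apply: lee_wpmul2l => //; rewrite lee_fin ltW.
Qed.

Lemma first_stays_step a0 m w : (forall w, a 0 w = a0) -> first_stays m w ->
  a m w = theta ^+ m * a0.
Proof.
move=> ha0; elim: m => [|m IH] /=; first by rewrite ha0 mul1r.
by move=> [Bw /IH h]; rewrite aB// h exprS mulrA.
Qed.

Lemma first_staysP m w k : first_stays m w -> (k < m)%N -> B k w.
Proof.
elim: m => // m IH /= [Bw /IH h]; rewrite ltnS leq_eqVlt => /predU1P[->//|].
exact: h.
Qed.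

End random_walk.

(** * The iterates of probabilistic direct search *)

Section pds.
Context (R : realType) (n : nat) (f : 'rV[R]_n -> R) (x0 : 'rV[R]_n)
  (alpha0 theta gamma : R) (rho : R -> R).
Hypothesis alpha0_gt0 : 0 < alpha0.
Hypothesis theta_gt0 : 0 < theta.
Hypothesis theta_lt1 : theta < 1.
Hypothesis gamma_ge1 : 1 <= gamma.
Hypothesis rho_gt0 : forall a, 0 < a -> 0 < rho a.
Context (disp : measure_display) (Omega : measurableType disp)
  (P : probability Omega R)
  (D : nat -> Omega -> seq 'rV[R]_n) (X : nat -> Omega -> 'rV[R]_n)
  (A : nat -> Omega -> R).
Hypothesis pds : PDS f x0 alpha0 theta gamma rho D X A.
Hypothesis f_convex :
  convex_function (setT : set (convex_lmodType 'rV[R]_n)) f.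

Lemma step_size_gt0 k w : 0 < A k w.
Proof.
elim: k => [|k IH]; first by rewrite (PDS_A0 pds).
have [h|h] := pselect (exists2 d, d \in D k w &
   sufficient_decrease f rho (X k w) (A k w) d).
  by have [_ ->] := PDS_success pds h; rewrite mulr_gt0// (lt_le_trans ltr01).
by have [_ ->] := PDS_failure pds h; rewrite mulr_gt0.
Qed.

(** A successful step moves the iterate, because directions have norm [1]. *)
Lemma stay_iff_failure k w :
  X k.+1 w = X k w <-> ~ (exists2 d, d \in D k w &
    sufficient_decrease f rho (X k w) (A k w) d).
Proof.
split => [XX h|h]; last by have [] := PDS_failure pds h.
have [[d [dD _ Xd]] _] := PDS_success pds h.
have /eqP := XX; rewrite Xd addrC -subr_eq0 addrK scaler_eq0.
rewrite gt_eqF ?step_size_gt0//= => /eqP d0.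
have := PDS_unit pds dD; rewrite d0 enorm0 => /eqP.
by rewrite eq_sym oner_eq0.
Qed.

Lemma ascent_stay k : ascent_event f (D k) (X k) `<=` [set w | X k.+1 w = X k w].
Proof.
move=> w /bigmin_ge0P h; apply/stay_iff_failure => -[d dD].
rewrite /sufficient_decrease ltNge => /negP; apply.
have /(clarke_ge0P f_convex)/(_ _ (step_size_gt0 k w)) hd := h _ dD.
by rewrite (le_trans _ (ltW (rho_gt0 (step_size_gt0 k w))))// subr_le0.
Qed.

Lemma step_stay k w : X k.+1 w = X k w -> A k.+1 w = theta * A k w.
Proof. by move=> /stay_iff_failure h; have [] := PDS_failure pds h. Qed.

Lemma step_move k w : X k.+1 w <> X k w -> A k.+1 w = gamma * A k w.
Proof.
move=> h; have [/(PDS_success pds)[]//|hf] := pselect (exists2 d, d \in D k w &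
   sufficient_decrease f rho (X k w) (A k w) d).
by exfalso; apply: h; apply/stay_iff_failure.
Qed.

Lemma step_length k w : `|X k.+1 w - X k w| <= A k w.
Proof.
have A0 := ltW (step_size_gt0 k w).
have [h|h] := pselect (exists2 d, d \in D k w &
   sufficient_decrease f rho (X k w) (A k w) d).
  have [[d [dD _ ->]] _] := PDS_success pds h.
  rewrite addrAC subrr add0r normrZ ger0_norm// ler_piMr//.
  by rewrite -(PDS_unit pds dD) norm_le_enorm.
by have [-> _] := PDS_failure pds h; rewrite subrr normr0.
Qed.

Context (p : R).
Hypothesis p_le1 : p <= 1.
Hypothesis ascent : probabilistic_ascent f P D X p.
Hypothesis p_gt : p_star theta gamma < p.

Lemma prob_gt0 : 0 < p.
Proof.
apply: le_lt_trans p_gt; rewrite divr_ge0// ln_ge0//.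
by rewrite (le_trans gamma_ge1)// ler_peMl ?(le_trans ler01)// invf_ge1 ?ltW.
Qed.

Lemma stay_probability k H : past D X k H ->
  (p%:E * P H <= P ([set w | X k.+1 w = X k w] `&` H))%E.
Proof.
move=> FH.
have mD := PDS_random_directions pds; have mX := PDS_random_iterates pds.
have Fm := past_measurable mD mX.
have [Z HZ pZ] := ascent k.
apply: (le_trans (conditional_probability_ge (ltW prob_gt0) (Fm k) HZ pZ FH)).
have mH := Fm _ _ FH.
have mS := Fm _ _ (past_stay (D := D) (k := k) (PDS_X0 pds)).
apply: le_measure; rewrite ?inE.
- apply: measurableI => //.
  exact: measurable_ascent_event.
- exact: measurableI.
- by apply: setSI; exact: ascent_stay.
Qed.

(** All the iterates stay in a ball of radius [M * theta ^+ m] when the first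
    [m] iterations stall and the step sizes decay geometrically afterwards. *)
Lemma iterates_localized : exists2 M : R, 0 < M & forall m : nat,
  exists G : set Omega, [/\ measurable G, ((p ^+ m / 2)%:E <= P G)%E &
    forall w k, G w -> `|X k w - x0| <= M * theta ^+ m].
Proof.
have p0 := prob_gt0.
have mD := PDS_random_directions pds; have mX := PDS_random_iterates pds.
have Fm := past_measurable mD mX.
pose F := past D X.
pose B k := [set w | X k.+1 w = X k w].
have Fs k : sigma_algebra setT (F k) by exact: past_sigma_algebra.
have Fmono k : F k `<=` F k.+1 by exact: past_mono.
have FB k : F k.+1 (B k) by apply: past_stay => //; exact: PDS_X0 pds.
have [s s0 r1] := powR_drift_lt1 theta_gt0 theta_lt1 gamma_ge1 (ltW p0) p_le1 p_gt.
have [K [q [K0 q0 q1 decay]]] := walk_decay (B := B) Fs Fm Fmono FB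
  stay_probability (PDS_random_steps pds) theta_gt0 theta_lt1 gamma_ge1 p0 p_le1
  step_stay step_move s0 r1.
have q10 : 0 < 1 - q by rewrite subr_gt0.
exists (K * alpha0 / (1 - q)); first by rewrite !mulr_gt0// invr_gt0.
move=> m; set c := theta ^+ m * alpha0.
have c0 : 0 < c by rewrite mulr_gt0// exprn_gt0.
have FE := first_staysF Fs Fmono FB m.
have aE w : first_stays B m w -> A m w <= c.
  by move=> Ew; rewrite (first_stays_step step_stay (PDS_A0 pds)).
have [G [mG GE PG AG]] := decay m _ c FE aE c0.
exists G; split => //.
  have := le_trans (first_stays_prob Fs Fmono FB stay_probability p0 m) PG.
  have -> : P G = (fine (P G))%:E by rewrite fineK// fin_num_measure.
  by rewrite -EFinM !lee_fin ler_pdivrMr// mulrC.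
move=> w k Gw.
have start j : (j <= m)%N -> X j w = x0.
  elim: j => [|j IH] jm; first exact: PDS_X0 pds w.
  by rewrite (first_staysP (GE _ Gw) jm) IH// ltnW.
have M0 : 0 <= K * alpha0 / (1 - q) * theta ^+ m.
  by rewrite !mulr_ge0 ?invr_ge0 ?exprn_ge0 ?ltW.
have [km|/ltnW mk] := leqP k m; first by rewrite start// subrr normr0.
rewrite -(subnKC mk); set j := (k - m)%N.
apply: (@le_trans _ _ (K * c * ((1 - q ^+ j) / (1 - q)))).
  elim: (j) => [|i IH]; first by rewrite addn0 start// subrr normr0 expr0 subrr mul0r mulr0.
  rewrite addnS -(subrK (X (m + i)%N w) (X (m + i).+1 w)) -addrA.
  apply: (le_trans (ler_normD _ _)).
  apply: (le_trans (lerD (le_trans (step_length _ _) (AG w i Gw)) IH)).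
  rewrite le_eqVlt; apply/orP; left; apply/eqP; rewrite exprS.
  by field; rewrite gt_eqF.
rewrite (_ : _ * theta ^+ m = K * c * (1 / (1 - q))); last by rewrite /c; ring.
apply: ler_wpM2l; first by rewrite mulr_ge0 ?(ltW K0) ?(ltW c0).
by rewrite ler_pM2r ?invr_gt0// lerBlDr lerDl exprn_ge0// ltW.
Qed.

Lemma iterates_stay_near (e : R) : 0 < e ->
  exists2 G : set Omega, measurable G /\ (0 < P G)%E &
    forall w k, G w -> `|X k w - x0| < e.
Proof.
move=> e0; have [M M0 HM] := iterates_localized.
have : M * theta ^+ m @[m --> \oo] --> M * 0.
  by apply: cvgMr; apply: cvg_expr; rewrite ger0_norm ?ltW.
rewrite mulr0 => /cvgr_lt/(_ _ e0)[m _ /(_ m (leqnn m)) Mm].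
have [G [mG PG XG]] := HM m.
exists G; last by move=> w k Gw; exact: le_lt_trans (XG w k Gw) Mm.
split => //; apply: lt_le_trans PG.
by rewrite lte_fin divr_gt0// exprn_gt0// prob_gt0.
Qed.

(** * Optimality measures along the iterates *)

(** The event is a countable intersection of preimages of open sets. *)
Lemma measurable_inf_along_ge (mu : 'rV[R]_n -> \bar R) (c : R) :
  lower_semicontinuous mu -> measurable [set w | (c%:E <= inf_along X mu w)%E].
Proof.
move=> /lower_semicontinuousP lsc.
have -> : [set w | (c%:E <= inf_along X mu w)%E] =
    \bigcap_k \bigcap_i (X k @^-1` [set x | ((c - i.+1%:R^-1)%:E < mu x)%E]).
  apply/seteqP; split => w /=.
    move=> h k _ i _ /=; apply: lt_le_trans (_ : (c%:E <= mu (X k w))%E).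
      by rewrite lte_fin gtrBl invr_gt0.
    by apply: (le_trans h); apply: ereal_inf_lbound; exists k.
  move=> h; apply: le_ereal_inf_tmp => _ [k _ <-].
  apply/lee_subgt0Pr => e e0.
  have [i _ /(_ _ (leqnn i)) ie] := near_infty_natSinv_lt (PosNum e0).
  rewrite -EFinB; apply: le_trans (ltW (h k I i I)).
  by rewrite lee_fin lerD2l lerN2 ltW.
apply: bigcap_measurableType => k _; apply: bigcap_measurableType => i _.
rewrite -[X in measurable X]setTI.
apply: (PDS_random_iterates pds k) => //.
exact: sub_sigma_algebra.
Qed.

Lemma inf_along_gt0_lower_bound (mu : 'rV[R]_n -> \bar R) w :
  (0 < inf_along X mu w)%E -> exists i : nat, (i.+1%:R^-1%:E <= inf_along X mu w)%E.
Proof.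
case: (inf_along X mu w) => [r| |]//; last by exists 0%N; rewrite leey.
rewrite lte_fin => r0.
have [i _ /(_ _ (leqnn i)) ie] := near_infty_natSinv_lt (PosNum r0).
by exists i; rewrite lee_fin ltW.
Qed.

Lemma measurable_inf_along_gt0 (mu : 'rV[R]_n -> \bar R) :
  lower_semicontinuous mu -> measurable [set w | (0 < inf_along X mu w)%E].
Proof.
move=> lsc; rewrite (_ : [set w | _] =
  \bigcup_i [set w | (i.+1%:R^-1%:E <= inf_along X mu w)%E]).
  by apply: bigcupT_measurable => i; exact: measurable_inf_along_ge.
apply/seteqP; split => w.
  by move=> /inf_along_gt0_lower_bound[i hi]; exists i.
by move=> [i _]; apply: lt_le_trans; rewrite lte_fin invr_gt0.
Qed.

Lemma inf_along_gt0_probability (mu : 'rV[R]_n -> \bar R) :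
  lower_semicontinuous mu -> (0 < mu x0)%E ->
  (0 < P [set w | (0 < inf_along X mu w)%E])%E.
Proof.
move=> lsc mu0.
have [c c0 cmu] : exists2 c : R, 0 < c & (c%:E < mu x0)%E.
  case: (mu x0) mu0 => [r| |]//; last by exists 1 => //; rewrite ltry.
  by rewrite lte_fin => r0; exists (r / 2); rewrite ?divr_gt0//
    lte_fin ltr_pdivrMr// ltr_pMr// ltr1n.
have [V /nbhs_ballP[e /= e0 eV] HV] := lsc _ _ cmu.
have [G [mG PG] XG] := iterates_stay_near e0.
apply: (lt_le_trans PG); apply: le_measure; rewrite ?inE//.
  exact: measurable_inf_along_gt0.
move=> w Gw /=; apply: (@lt_le_trans _ _ c%:E); first by rewrite lte_fin.
apply: le_ereal_inf_tmp => _ [k _ <-]; apply/ltW/HV/eV.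
by rewrite -ball_normE /= distrC XG.
Qed.

Lemma inf_along_ge_probability (mu : 'rV[R]_n -> \bar R) :
  lower_semicontinuous mu -> (0 < mu x0)%E -> locally_lipschitz_at mu x0 ->
  exists C zeta0 : R, [/\ 0 < C, 0 < zeta0 &
    forall zeta : R, 0 < zeta -> zeta < zeta0 ->
      ((C * zeta `^ (ln p / ln theta))%:E <=
       P [set w | (1 - zeta)%:E * mu x0 <= inf_along X mu w])%E].
Proof.
move=> lsc mu0 [U /nbhs_ballP[e /= e0 eU] [Ufin [L HL]]].
have [M M0 HM] := iterates_localized.
have Ux0 : U x0 by apply: eU; exact: ballxx.
have mux0 : mu x0 = (fine (mu x0))%:E by rewrite fineK// Ufin.
set v := fine (mu x0) in mux0.
have v0 : 0 < v by move: mu0; rewrite mux0 lte_fin.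
(* [L'] is a positive Lipschitz constant for the sup norm; [b] makes a
   displacement of [M * (b * zeta)] change [mu] by at most [zeta * mu x0] *)
pose L' := `|L| * Num.sqrt n%:R + 1.
have L'0 : 0 < L' by rewrite ltr_wpDl// mulr_ge0// sqrtr_ge0.
pose b := v / (L' * M).
have b0 : 0 < b by rewrite divr_gt0// mulr_gt0.
have p0 := prob_gt0.
have lnt : ln theta < 0 by rewrite ln_lt0// theta_gt0.
pose ex := ln p / ln theta.
exists (p * b `^ ex / 2), (Num.min b^-1 (e / (M * b))).
have C0 : 0 < p * b `^ ex / 2 by rewrite !mulr_gt0// powR_gt0.
have z0 : 0 < Num.min b^-1 (e / (M * b)).
  by rewrite lt_min invr_gt0 b0 divr_gt0// mulr_gt0.
split => // zeta zeta0; rewrite lt_min => /andP[zb ze].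
have bz0 : 0 < b * zeta by rewrite mulr_gt0.
have bz1 : b * zeta < 1 by rewrite mulrC -ltr_pdivlMr// div1r.
(* [m] is the smallest integer greater than [t], so that
   [theta ^+ m <= b * zeta] at the cost of at most one extra factor [p] *)
pose t := ln (b * zeta) / ln theta.
have t0 : 0 < t by rewrite /t nmulr_rgt0 ?invr_lt0// ln_lt0// bz0.
pose m := (Num.truncn t).+1.
have tm : t <= m%:R by rewrite ltW// truncnS_gt.
have mt : m%:R <= t + 1 by rewrite -natr1 lerD2r truncn_le// ltW.
have thetam : theta ^+ m <= b * zeta.
  by rewrite -ler_ln ?posrE ?exprn_gt0// lnXn// -mulr_natl -ler_ndivrMr.
have pm : p * (b * zeta) `^ ex <= p ^+ m.
  rewrite -ler_ln ?posrE ?exprn_gt0 ?mulr_gt0 ?powR_gt0//.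
  rewrite lnM ?posrE ?powR_gt0// lnXn// ln_powR -mulr_natl.
  have -> : ex * ln (b * zeta) = t * ln p by rewrite /ex /t; ring.
  have lnp : ln p <= 0 by rewrite ln_le0.
  by rewrite -{1}[ln p]mul1r -mulrDl [1 + t]addrC; apply: ler_wnM2r.
have [G [mG PG XG]] := HM m.
apply: (@le_trans _ _ (P G)).
  apply: le_trans PG; rewrite lee_fin -/ex mulrAC ler_pM2r ?invr_gt0//.
  by rewrite -mulrA -powRM// ltW.
rewrite mux0 -EFinM; apply: le_measure; rewrite ?inE//.
  exact: measurable_inf_along_ge.
move=> w Gw /=; apply: le_ereal_inf_tmp => _ [k _ <-].
have near_k : `|X k w - x0| <= M * (b * zeta).
  by apply: (le_trans (XG w k Gw)); rewrite ler_pM2l.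
have Uk : U (X k w).
  apply: eU; rewrite -ball_normE /= distrC (le_lt_trans near_k)//.
  by rewrite mulrA mulrC -ltr_pdivlMr ?(mulr_gt0 M0 b0).
rewrite -(fineK (Ufin _ Uk)) lee_fin.
have dist : `|v - fine (mu (X k w))| <= zeta * v.
  apply: (le_trans (HL _ _ Ux0 Uk)).
  have le1 : enorm (x0 - X k w) <= Num.sqrt n%:R * (M * (b * zeta)).
    apply: (le_trans (enorm_le_norm _)).
    by rewrite ler_wpM2l ?sqrtr_ge0// distrC.
  apply: (@le_trans _ _ (`|L| * (Num.sqrt n%:R * (M * (b * zeta))))).
    apply: (@le_trans _ _ (`|L| * enorm (x0 - X k w))); last by rewrite ler_wpM2l.
    by apply: ler_wpM2r; [exact: sqrtr_ge0 | exact: ler_norm].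
  have -> : zeta * v = L' * (M * (b * zeta)).
    by rewrite /b; field; rewrite !gt_eqF.
  rewrite [leLHS]mulrA; apply: ler_wpM2r; last by rewrite lerDl.
  by rewrite mulr_ge0 ?(ltW M0) ?(ltW bz0).
by move: dist; rewrite ler_distl => /andP[_]; rewrite mulrBl mul1r lerBlDr.
Qed.

End pds.

Theorem theorem4p1 (R : realType) (n : nat) (n_ge1 : (1 <= n)%N)
    (f : 'rV[R]_n -> R) (x0 : 'rV[R]_n) (alpha0 theta gamma : R)
    (rho : R -> R)
    (alpha0_gt0 : 0 < alpha0) (theta_gt0 : 0 < theta) (theta_lt1 : theta < 1)
    (gamma_ge1 : 1 <= gamma) (rho_forcing : forcing_function rho)
    (disp : measure_display) (Omega : measurableType disp)
    (P : probability Omega R)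
    (D : nat -> Omega -> seq 'rV[R]_n) (X : nat -> Omega -> 'rV[R]_n)
    (A : nat -> Omega -> R)
    (pds : PDS f x0 alpha0 theta gamma rho D X A)
    (f_convex :
      convex_function (setT : set (convex_lmodType 'rV[R]_n)) f)
    (p : R) (p_ge0 : 0 <= p) (p_le1 : p <= 1)
    (ascent : probabilistic_ascent f P D X p)
    (p_gt : p_star theta gamma < p) :
  [/\ (forall mu : 'rV[R]_n -> \bar R,
         (forall x, mu x != -oo%E) -> lower_semicontinuous mu ->
         (0 < mu x0)%E ->
         (0 < P [set w | 0 < inf_along X mu w])%E),
      (~ stationary f x0 ->
         [/\ (0 < P [set w | 0 < inf_along X
                (fun x => (f x)%:E - infimum f) w])%E,
             (0 < P [set w | 0 < inf_along X
                (fun x => gap [set x] (minimizers f)) w])%E &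
             (0 < P [set w | 0 < inf_along X
                (fun x => gap [set 0%R] (clarke_subdifferential f x)) w])%E]) &
      (forall mu : 'rV[R]_n -> \bar R,
         (forall x, mu x != -oo%E) -> lower_semicontinuous mu ->
         (0 < mu x0)%E -> locally_lipschitz_at mu x0 ->
         exists C zeta0 : R, [/\ 0 < C, 0 < zeta0 &
           forall zeta : R, 0 < zeta -> zeta < zeta0 ->
             ((C * zeta `^ (ln p / ln theta))%:E <=
              P [set w | (1 - zeta)%:E * mu x0 <= inf_along X mu w])%E])].
Proof.
have [rho_gt0 _ _] := rho_forcing.
have fc := convex_continuous f_convex.
have positive (mu : 'rV[R]_n -> \bar R) : lower_semicontinuous mu ->
    (0 < mu x0)%E -> (0 < P [set w | 0 < inf_along X mu w])%E.
  exact: (inf_along_gt0_probability alpha0_gt0 theta_gt0 theta_lt1 gamma_ge1 rho_gt0 pds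
    f_convex p_le1 ascent p_gt).
split.
- by move=> mu _ lsc mu0; exact: positive.
- move=> nst.
  have [y fyx] : exists y, f y < f x0.
    apply: contrapT => h; apply: nst; apply/(stationaryP f_convex) => y.
    by rewrite leNgt; apply/negP => fy; apply: h; exists y.
  split; apply: positive.
  + exact: lsc_optimality_gap.
  + exact: optimality_gap_gt0 fyx.
  + exact: lsc_gap_minimizers.
  + exact: gap_minimizers_gt0 fyx.
  + exact: lsc_gap_subdifferential.
  + exact: gap_subdifferential_gt0 fyx.
- move=> mu _ lsc mu0 lip.
  exact: (inf_along_ge_probability alpha0_gt0 theta_gt0 theta_lt1 gamma_ge1 rho_gt0 pds
    f_convex p_le1 ascent p_gt).
Qed.
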